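(* Let $\mathrm{C}_n:=[-1,1]^n$ be the monotone cube. If $P$ is an $n$-dimensional monotone polytope then, modulo unimodular equivalence (i.e. after replacing $P$ by a suitable unimodularly equivalent monotone polytope), $\mathcal{E}(P)\subset\mathcal{E}(\mathrm{C}_n)$. In particular, $|\mathcal{E}(P)|\le3^n$, and this bound is attained only if $P$ is (modulo unimodular equivalence) the monotone cube.
   Context: The Ewald set of a polytope $P\subset\mathbb{R}^n$ is $\mathcal{E}(P):=\mathbb{Z}^n\cap P\cap(-P)$. An $n$-dimensional polytope in $\mathbb{R}^n$ is smooth if it is simple, rational, and the primitive edge-direction vectors at each vertex form a basis of $\mathbb{Z}^n$. A lattice polytope (vertices in $\mathbb{Z}^n$) with the origin in its interior is reflexive if every facet-defining inequality is of the form $u_F\cdot x\le1$ with $u_F\in\mathbb{Z}^n$ the primitive exterior normal of the facet; monotone means smooth and reflexive. Two polytopes in $\mathbb{R}^n$ are unimodularly equivalent if one is mapped to the other by $x\mapsto Ax+t$ with $A\in\mathrm{GL}(n,\mathbb{Z})$, $t\in\mathbb{Z}^n$; for monotone (more generally reflexive) polytopes this is the same as $\mathrm{GL}(n,\mathbb{Z})$-equivalence, since the origin is the unique interior lattice point. *)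

(* Defs.v *)
From HB Require Import structures.
From mathcomp Require Import all_boot all_order all_algebra.
From mathcomp Require Import all_classical all_reals.
From mathcomp Require Import topology normedtype.

Set Implicit Arguments.
Unset Strict Implicit.
Unset Printing Implicit Defensive.

Import Order.TTheory GRing.Theory Num.Theory.
Import numFieldNormedType.Exports.

Local Open Scope classical_set_scope.
Local Open Scope card_scope.
Local Open Scope ring_scope.

Definition dot (R : realType) (n : nat) (u x : 'cV[R]_n) : R :=
  \sum_(i < n) u i 0 * x i 0.

Definition lattice (R : realType) (n : nat) : set 'cV[R]_n :=
  [set map_mx intr z | z in [set: 'cV[int]_n]].
Arguments lattice R n : clear implicits.

Definition primitive (n : nat) (u : 'cV[int]_n) : Prop :=
  \big[gcdn/0%N]_(i < n) absz (u i 0) = 1%N.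

(* The columns of V are the points whose convex hull is taken. *)
Definition polytope (R : realType) (n : nat) (P : set 'cV[R]_n) : Prop :=
  exists (k : nat) (V : 'M[R]_(n, k)),
    P = [set V *m c | c in [set c : 'cV[R]_k |
                              (forall i, 0 <= c i 0) /\ \sum_i c i 0 = 1]].

(* U is the direction space of the affine hull of F. *)
Definition has_dim (R : realType) (n : nat) (F : set 'cV[R]_n) (d : nat) : Prop :=
  exists (x0 : 'cV[R]_n) (U : {vspace 'cV[R]_n}),
    [/\ F x0,
        forall x, F x -> x - x0 \in U,
        forall W : {vspace 'cV[R]_n},
          (forall x, F x -> x - x0 \in W) -> (U <= W)%VS
      & \dim U = d].

Definition face_by (R : realType) (n : nat) (P F : set 'cV[R]_n)
    (u : 'cV[R]_n) (c : R) : Prop :=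
  (forall x, P x -> dot u x <= c) /\ F = P `&` [set x | dot u x = c].

(* u = 0 is allowed, so that P is a face of itself (in dimension 1, the
   polytope is its own unique edge). *)
Definition face (R : realType) (n : nat) (P F : set 'cV[R]_n) : Prop :=
  exists (u : 'cV[R]_n) (c : R), face_by P F u c.

Definition vertex (R : realType) (n : nat) (P : set 'cV[R]_n) (v : 'cV[R]_n) : Prop :=
  face P [set v].

Definition edge (R : realType) (n : nat) (P E : set 'cV[R]_n) : Prop :=
  face P E /\ has_dim E 1.

(* For polytopes of full dimension n. *)
Definition facet (R : realType) (n : nat) (P F : set 'cV[R]_n) : Prop :=
  face P F /\ exists2 d : nat, n = d.+1 & has_dim F d.

Definition simple_polytope (R : realType) (n : nat) (P : set 'cV[R]_n) : Prop :=
  forall v, vertex P v -> [set E | edge P E /\ E v] #= `I_n.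

(* Every edge is parallel to an integer vector. *)
Definition rational_polytope (R : realType) (n : nat) (P : set 'cV[R]_n) : Prop :=
  forall E, edge P E ->
    exists2 u : 'cV[int]_n, u != 0 &
      forall x y, E x -> E y -> exists t : R, y - x = t *: map_mx intr u.

Definition primitive_edge_directions (R : realType) (n : nat)
    (P : set 'cV[R]_n) (v : 'cV[R]_n) : set 'cV[int]_n :=
  [set u | primitive u /\
     exists E (t : R), [/\ edge P E, E v, 0 < t & E (v + t *: map_mx intr u)]].

Definition columns_basis (n : nat) (B : 'M[int]_n) : Prop :=
  forall z : 'cV[int]_n, exists! c : 'cV[int]_n, z = B *m c.

Definition smooth_polytope (R : realType) (n : nat) (P : set 'cV[R]_n) : Prop :=
  [/\ polytope P, has_dim P n, simple_polytope P, rational_polytope P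
    & forall v, vertex P v ->
        exists2 B : 'M[int]_n, columns_basis B &
          primitive_edge_directions P v = [set col j B | j in [set: 'I_n]]].

Definition lattice_polytope (R : realType) (n : nat) (P : set 'cV[R]_n) : Prop :=
  polytope P /\ forall v, vertex P v -> lattice R n v.

Definition reflexive_polytope (R : realType) (n : nat) (P : set 'cV[R]_n) : Prop :=
  [/\ lattice_polytope P, interior P 0
    & forall F, facet P F ->
        exists2 u : 'cV[int]_n, primitive u & face_by P F (map_mx intr u) 1].

Definition monotone_polytope (R : realType) (n : nat) (P : set 'cV[R]_n) : Prop :=
  smooth_polytope P /\ reflexive_polytope P.

Definition unimodularly_equivalent (R : realType) (n : nat)
    (P Q : set 'cV[R]_n) : Prop :=
  exists (A : 'M[int]_n) (t : 'cV[int]_n),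
    A \in unitmx /\ Q = [set map_mx intr A *m x + map_mx intr t | x in P].

Definition ewald (R : realType) (n : nat) (P : set 'cV[R]_n) : set 'cV[R]_n :=
  lattice R n `&` P `&` [set - x | x in P].

Definition cube (R : realType) (n : nat) : set 'cV[R]_n :=
  [set x | forall i, -1 <= x i 0 <= 1].
Arguments cube R n : clear implicits.

(* Main.v *)
Require Import Defs.
From mathcomp Require Import all_boot all_order all_algebra.
From mathcomp Require Import all_classical all_reals.
From mathcomp Require Import topology normedtype.
From mathcomp Require Import finmap zify ring lra.

(** Everything rests on one local fact, [monotone_vertex_chart]: at a vertex v
of a monotone polytope P there is a matrix U in GL(n, Z) such that every point
x of P satisfies U x <= 1 coordinatewise, with equality in all coordinates at
v.  Its rows are the normals of the n facets through v.  Smoothness says that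
the primitive edge directions at v are the columns of a unimodular matrix B;
P lies in the cone that they span at v ([vertex_max_of_edges]), hence each row
of -B^-1 is maximised over P on a face containing n - 1 of these edges, that
is, on a facet; reflexivity then forces this row to be the primitive normal of the
facet, with right-hand side 1.

Replace P by Q = U P.  Every point of Q has all its coordinates at most 1, so a
point of Q whose opposite is also in Q lies in the cube.  This gives the
inclusion of Ewald sets, and the bound 3^n, which is the number of lattice
points of the cube.

If the bound is attained, Q contains all the vectors with coordinates 1 and -1,
hence the whole cube by convexity.  Apply the local fact to Q at a vertex w: a
row u of the matrix obtained satisfies u x <= 1 for all sign vectors x, that
is, the sum of the |u_i| is at most 1, so u is plus or minus a standard basis
vector.  The matrix is invertible, so each coordinate of w is 1 or -1
([sign_chart_vertex]).  All the vertices of Q are therefore in the cube, and so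
is Q, because a linear form on a polytope is maximal at some vertex
([polytope_vertex_max]).

The existence of vertices and of edges, defined as exposed faces, both come
from [exists_exposed_maximizer], a statement on finite families of vectors. *)

Set Implicit Arguments.
Unset Strict Implicit.
Unset Printing Implicit Defensive.

Import Order.TTheory GRing.Theory Num.Theory.
Import numFieldNormedType.Exports.

(** * The scalar product and exposed maximizers *)

Section Dot.
Local Open Scope ring_scope.
Variables (R : realType) (n : nat).
Implicit Types (u v x y : 'cV[R]_n).

Lemma dotE u x : dot u x = (u^T *m x) 0 0.
Proof. by rewrite /dot mxE; apply: eq_bigr => i _; rewrite mxE. Qed.

Lemma dotC u x : dot u x = dot x u.
Proof. by apply: eq_bigr => i _; rewrite mulrC. Qed.

Lemma dotDr u x y : dot u (x + y) = dot u x + dot u y.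
Proof. by rewrite !dotE mulmxDr mxE. Qed.

Lemma dotNr u x : dot u (- x) = - dot u x.
Proof. by rewrite !dotE mulmxN mxE. Qed.

Lemma dotBr u x y : dot u (x - y) = dot u x - dot u y.
Proof. by rewrite dotDr dotNr. Qed.

Lemma dotZr t u x : dot u (t *: x) = t * dot u x.
Proof. by rewrite !dotE -scalemxAr mxE. Qed.

Lemma dotDl u v x : dot (u + v) x = dot u x + dot v x.
Proof. by rewrite dotC dotDr ![dot x _]dotC. Qed.

Lemma dotZl t u x : dot (t *: u) x = t * dot u x.
Proof. by rewrite dotC dotZr dotC. Qed.

Lemma dot_sumr (I : finType) (F : I -> 'cV[R]_n) u :
  dot u (\sum_i F i) = \sum_i dot u (F i).
Proof. by rewrite dotE mulmx_sumr summxE; apply: eq_bigr => i _; rewrite dotE. Qed.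

Lemma dot_gt0 u : u != 0 -> 0 < dot u u.
Proof.
move=> u0; have /matrix0Pn[i [j uij]] := u0.
rewrite /dot (bigD1 i) //=; apply: ltr_pwDl; last first.
  by apply: sumr_ge0 => k _; rewrite -expr2 sqr_ge0.
by rewrite -expr2 exprn_even_gt0 //= -(ord1 j).
Qed.

(** Among the maximizers of [a], take one of largest Euclidean norm, [d i].  By
Cauchy-Schwarz it is the only maximizer of [dot (d i)] among them, and adding
a large multiple of [a] takes care of the members of the family that do not
maximize [a].  Thus some maximizer of [a] is exposed by a linear form [g]. *)
Lemma exists_exposed_maximizer (I : finType) (p : pred I) (d : I -> 'cV[R]_n)
    (a : 'cV[R]_n) (i0 : I) : p i0 ->
  exists i g, [/\ p i, forall j, p j -> dot a (d j) <= dot a (d i)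
    & forall j, p j -> d j != d i -> dot g (d j) < dot g (d i)].
Proof.
move=> pi0.
have [i1 pi1 max1] : exists2 i1, p i1 &
    forall j, p j -> dot a (d j) <= dot a (d i1).
  by case: (arg_maxP (fun i => dot a (d i)) pi0) => i1; exists i1.
have p1 : p i1 && (dot a (d i1) == dot a (d i1)) by rewrite pi1 eqxx.
case: (arg_maxP (P := fun i => p i && (dot a (d i) == dot a (d i1)))
  (fun i => dot (d i) (d i)) p1) => i2 /andP[pi2 /eqP a2] max2.
(* The multiple M must beat each difference of values of [dot (d i2)] over the
   positive gap in the values of [a]; when the gap is 0, so is the quotient. *)
pose M := 1 + \sum_j `|dot (d i2) (d j - d i2)| / `|dot a (d i2 - d j)|.
exists i2, (M *: a + d i2); split => //; first by move=> j /max1; rewrite a2.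
move=> j pj dj; rewrite -subr_lt0 -dotBr dotDl dotZl.
have [aj|aj] := eqVneq (dot a (d j)) (dot a (d i1)).
  rewrite [dot a _]dotBr aj a2 subrr mulr0 add0r.
  have := max2 j; rewrite pj aj eqxx => /(_ isT).
  have := dot_gt0 (u := d j - d i2); rewrite subr_eq0 => /(_ dj).
  rewrite !dotBr ![dot (_ - _) _]dotC !dotBr [dot (d i2) (d j)]dotC /=.
  by lra.
have gap : 0 < dot a (d i2 - d j).
  by rewrite dotBr subr_gt0 a2 lt_neqAle aj max1.
have -> : d j - d i2 = - (d i2 - d j) by rewrite opprB.
rewrite [dot a _]dotNr mulrN addrC subr_lt0.
have Mge : 1 + `|dot (d i2) (d j - d i2)| / `|dot a (d i2 - d j)| <= M.
  rewrite lerD2l (bigD1 j) //= lerDl; apply: sumr_ge0 => k _.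
  by rewrite divr_ge0.
apply: lt_le_trans (ler_wpM2r (ltW gap) Mge).
rewrite mulrDl mul1r (gtr0_norm gap) divfK ?gt_eqF// opprB.
by apply: ltr_pwDl => //; exact: ler_norm.
Qed.

End Dot.

Lemma dot_mulmx (R : realType) n m (A : 'M[R]_(n, m)) (u : 'cV[R]_n)
    (x : 'cV[R]_m) :
  (dot u (A *m x) = dot (A^T *m u) x)%R.
Proof. by rewrite !dotE trmx_mul trmxK mulmxA. Qed.

(** * Convex hulls of finitely many points *)

Section Hull.
Local Open Scope classical_set_scope.
Local Open Scope ring_scope.
Variables (R : realType) (n k : nat) (V : 'M[R]_(n, k)).
Implicit Types (u : 'cV[R]_n) (c : 'cV[R]_k).

Definition hull := [set V *m c | c in [set c : 'cV[R]_k |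
  (forall i, 0 <= c i 0) /\ \sum_i c i 0 = 1]].

Lemma hull_col i : hull (col i V).
Proof.
exists (delta_mx i 0); last by rewrite colE.
split => [j|]; first by rewrite mxE eqxx andbT ler0n.
rewrite (bigD1 i) //= mxE !eqxx big1 ?addr0 // => j /negPf ji.
by rewrite mxE ji.
Qed.

Lemma mulmx_col_sum c : V *m c = \sum_i c i 0 *: col i V.
Proof.
apply/matrixP => i j; rewrite ord1 mxE summxE; apply: eq_bigr => l _.
by rewrite !mxE mulrC.
Qed.

Lemma dot_hull u c : dot u (V *m c) = \sum_i c i 0 * dot u (col i V).
Proof. by rewrite mulmx_col_sum dot_sumr; apply: eq_bigr => i _; rewrite dotZr. Qed.

Lemma hull_le u (m : R) : (forall i, dot u (col i V) <= m) ->
  forall x, hull x -> dot u x <= m.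
Proof.
move=> um x [c [c0 c1] <-]; rewrite dot_hull -[m]mul1r -c1 mulr_suml.
by apply: ler_sum => i _; rewrite ler_wpM2l.
Qed.

(** The deficits [m - dot u (col i V)] are nonnegative and their mean with weights
[c] is 0.  Hence a face of the hull is the hull of the generators in it. *)
Lemma hull_eq u (m : R) c : (forall i, dot u (col i V) <= m) ->
  (forall i, 0 <= c i 0) -> \sum_i c i 0 = 1 -> dot u (V *m c) = m ->
  forall i, dot u (col i V) < m -> c i 0 = 0.
Proof.
move=> um c0 c1 cm i im.
have /psumr_eq0P s0 : forall j, true -> 0 <= c j 0 * (m - dot u (col j V)).
  by move=> j _; rewrite mulr_ge0 ?subr_ge0.
have /s0/(_ i isT)/eqP : \sum_j c j 0 * (m - dot u (col j V)) = 0.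
  under eq_bigr do rewrite mulrBr.
  by rewrite sumrB -mulr_suml c1 -dot_hull cm mul1r subrr.
by rewrite mulf_eq0 subr_eq0 (gt_eqF im) orbF => /eqP.
Qed.

Lemma hull_index : hull !=set0 -> exists i : 'I_k, true.
Proof.
move=> h; apply: contrapT => nk; case: h => _ [c [_ c1] _]; move: c1.
rewrite big1 => [/esym/eqP|i]; first by rewrite oner_eq0.
by exfalso; apply: nk; exists i.
Qed.

(** An exposed maximizer among the generators is an exposed point of their
hull. *)
Lemma hull_vertex_max (a : 'cV[R]_n) : hull !=set0 ->
  exists w, vertex hull w /\ forall x, hull x -> dot a x <= dot a w.
Proof.
move=> /hull_index[i0 _].
have [i [g [_ amax gmax]]] :=
  exists_exposed_maximizer (p := predT) (fun j => col j V) a (i0 := i0) isT.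
exists (col i V); split; last by apply: hull_le => j; exact: amax.
have gle j : dot g (col j V) <= dot g (col i V).
  by have [->//|ne] := eqVneq (col j V) (col i V); apply/ltW/gmax.
exists g, (dot g (col i V)); split; first exact: hull_le.
apply/seteqP; split => [_ ->|]; first by split => //; exact: hull_col.
move=> _ [[c [c0 c1] <-] /= ceq].
rewrite mulmx_col_sum -[RHS]scale1r -c1 scaler_suml; apply: eq_bigr => j _.
have [->//|ne] := eqVneq (col j V) (col i V).
by rewrite (hull_eq gle c0 c1 ceq) ?scale0r //; exact: gmax.
Qed.

End Hull.

(** * Primitive integer vectors *)

Section Primitive.
Local Open Scope ring_scope.
Variable n : nat.
Implicit Types (u w z : 'cV[int]_n).

Lemma primitiveP u :
  primitive u <-> forall d : nat, (forall i, d %| absz (u i ord0))%N -> d = 1%N.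
Proof.
rewrite /primitive; split => [u1 d du|]; last first.
  by apply => i; apply: biggcdn_inf (dvdnn _).
by apply/eqP; rewrite -dvdn1 -u1; apply/dvdn_biggcdP.
Qed.

Lemma primitive_scale z : z != 0 ->
  exists w (g : nat), [/\ primitive w, (0 < g)%N & z = g%:Z *: w].
Proof.
move=> z0; pose g := \big[gcdn/0%N]_(i < n) absz (z i 0).
have gz i : (g %| absz (z i ord0))%N by apply: biggcdn_inf (dvdnn _).
have g0 : (0 < g)%N.
  rewrite lt0n; apply: contraNneq z0 => g0; apply/eqP/matrixP => i j.
  rewrite ord1 mxE; apply/eqP; rewrite -absz_eq0 -dvd0n.
  by have := gz i; rewrite g0.
exists (\col_i (z i ord0 %/ g%:Z)%Z), g; split => //; last first.
  apply/matrixP => i j; rewrite !mxE ord1 mulrC divzK //; exact: gz.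
apply/primitiveP => d dw.
have : (d * g %| g)%N.
  apply/dvdn_biggcdP => i _; have := dw i; rewrite mxE => dwi.
  have -> : z i 0 = (z i ord0 %/ g%:Z)%Z * g%:Z by rewrite divzK //; exact: gz.
  by rewrite abszM /= dvdn_mul.
by rewrite -{2}[g]mul1n dvdn_pmul2r // dvdn1 => /eqP.
Qed.

Lemma primitiveN u : primitive u -> primitive (- u).
Proof.
by move=> u1; apply: etrans u1; apply: eq_bigr => i _; rewrite mxE abszN.
Qed.

End Primitive.

(** * Vertices and edges of a polytope *)

Section Cone.
Local Open Scope classical_set_scope.
Local Open Scope ring_scope.
Variables (R : realType) (n : nat) (P : set 'cV[R]_n).

Lemma polytope_vertex_max a : polytope P -> P !=set0 ->
  exists w, vertex P w /\ forall x, P x -> dot a x <= dot a w.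
Proof. by move=> [k [V ->]]; exact: hull_vertex_max. Qed.

Lemma vertex_in v : vertex P v -> P v.
Proof. by move=> [u [c [_ /seteqP[/(_ v erefl)[]]]]]. Qed.

Lemma vertex_strict v : vertex P v ->
  exists u, forall x, P x -> x != v -> dot u x < dot u v.
Proof.
move=> [u [c [uc /seteqP[/(_ v erefl)[Pv /= uv] F]]]]; exists u => x Px xv.
rewrite uv lt_neqAle uc // andbT; apply: contraNneq xv => ux.
by apply/eqP; apply: F.
Qed.

(** Divide the integer direction of the edge by the gcd of its coordinates, and
replace it by its opposite if it points from [x] to [v]. *)
Lemma edge_primitive_direction v x E : rational_polytope P -> edge P E ->
  E v -> E x -> x != v ->
  exists z (t : R), [/\ primitive_edge_directions P v z, 0 < t
    & x - v = t *: map_mx intr z].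
Proof.
move=> ratP eE Ev Ex xv; have [z z0 zE] := ratP _ eE.
have [w [g [w1 g0 zw]]] := primitive_scale z0.
have [t xvt] := zE _ _ Ev Ex.
have t0 : t != 0.
  by apply: contraNneq xv => t0; rewrite -subr_eq0 xvt t0 scale0r.
have dir (s : R) y : 0 < s -> primitive y -> x - v = s *: map_mx intr y ->
    primitive_edge_directions P v y.
  by move=> s0 y1 xvs; split => //; exists E, s; split => //; rewrite -xvs addrC subrK.
have xvw : x - v = (t * g%:R) *: map_mx intr w.
  rewrite xvt zw -scalerA; congr (_ *: _).
  by apply/matrixP => i j; rewrite !mxE rmorphM.
have tg0 : t * g%:R != 0 by rewrite mulf_neq0 // pnatr_eq0 -lt0n.
have [s0|s0] := ltP 0 (t * g%:R).
  by exists w, (t * g%:R); split => //; apply: dir xvw.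
have s0' : 0 < - (t * g%:R) by rewrite oppr_gt0 lt_neqAle tg0.
have xvw' : x - v = (- (t * g%:R)) *: map_mx intr (- w).
  by rewrite map_mxN scalerN scaleNr opprK.
exists (- w), (- (t * g%:R)); split => //.
by apply: dir xvw' => //; exact: primitiveN.
Qed.

(** A vertex that no incident edge improves is a maximum, so that P lies in the
cone spanned at [v] by the edges.  Otherwise, rescale the vectors from [v] to
the other generators of P so that they end on a common hyperplane: the resulting
[d j] span the vertex figure, and [a] is positive on some of them.  An exposed
maximizer [d l] of [a] among them is a vertex of the vertex figure, and it is
the direction of an edge of P along which [a] increases. *)
Lemma vertex_max_of_edges v a : polytope P -> rational_polytope P ->
  vertex P v ->
  (forall z, primitive_edge_directions P v z -> dot a (map_mx intr z) <= 0) ->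
  forall x, P x -> dot a x <= dot a v.
Proof.
move=> [k [V PV]] ratP vv az; have Pv := vertex_in vv.
have [u uv] := vertex_strict vv.
have Pcol i : P (col i V) by rewrite PV; exact: hull_col.
suff acol i : dot a (col i V) <= dot a v by rewrite PV; exact: hull_le.
rewrite leNgt; apply/negP => ai.
(* [s] measures the depth below [v], so that the [d j] are all at depth 1. *)
pose s i := dot u (v - col i V).
have s0 j : col j V != v -> 0 < s j.
  by move=> jv; rewrite /s dotBr subr_gt0 uv.
pose d j := (s j)^-1 *: (col j V - v).
have col_depthE j : col j V != v -> col j V - v = s j *: d j.
  by move=> jv; rewrite /d scalerA divff ?scale1r // gt_eqF // s0.
have iv : col i V != v by apply: contraTneq ai => ->; rewrite ltxx.
have [l [g [lv amax gmax]]] :=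
  exists_exposed_maximizer (p := fun j => col j V != v) d a iv.
have ad : 0 < dot a (d l).
  apply: lt_le_trans (amax i iv).
  by rewrite dotZr dotBr mulr_gt0 ?invr_gt0 ?s0 // subr_gt0.
have ud j : col j V != v -> dot u (d j) = -1.
  move=> jv; rewrite /d dotZr -opprB dotNr -/(s j) mulrN mulVf //.
  by rewrite gt_eqF // s0.
(* As [u] is -1 on all the [d j], adding this multiple of [u] makes [g] vanish
   at [d l] and negative at the others: [h] exposes the edge. *)
pose h := g + dot g (d l) *: u.
have hd j : col j V != v -> dot h (d j) = dot g (d j) - dot g (d l).
  by move=> jv; rewrite dotDl dotZl ud // mulrN1.
have hcol j : col j V != v -> dot h (col j V) - dot h v = s j * dot h (d j).
  by move=> jv; rewrite -dotBr col_depthE // dotZr.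
have hlt j : col j V != v -> d j != d l -> dot h (col j V) < dot h v.
  move=> jv jl; rewrite -subr_lt0 hcol // pmulr_rlt0 ?s0 // hd // subr_lt0.
  exact: gmax.
have hl j : col j V != v -> d j = d l -> dot h (col j V) = dot h v.
  by move=> jv jl; apply/eqP; rewrite -subr_eq0 hcol // hd // jl subrr mulr0.
have hle j : dot h (col j V) <= dot h v.
  have [->//|jv] := eqVneq (col j V) v.
  have [jl|jl] := eqVneq (d j) (d l); first by rewrite hl.
  exact/ltW/hlt.
pose E := P `&` [set x | dot h x = dot h v].
have Ev : E v by [].
have El : E (col l V) by split => //=; apply: hl.
have Eline x : E x -> x - v \in <[d l]>%VS.
  case; rewrite PV => -[c [c0 c1] <-] /= ce.
  rewrite mulmx_col_sum -[v]scale1r -c1 scaler_suml -sumrB.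
  apply: memv_suml => j _; rewrite -scalerBr.
  have [->|jv] := eqVneq (col j V) v; first by rewrite subrr scaler0 mem0v.
  have [jl|jl] := eqVneq (d j) (d l).
    by rewrite col_depthE // jl; do 2!apply: memvZ; exact: memv_line.
  by rewrite (hull_eq hle c0 c1 ce) ?scale0r ?mem0v //; exact: hlt.
have eE : edge P E.
  split.
    exists h, (dot h v); split => //; rewrite PV; exact: hull_le.
  exists v, <[d l]>%VS; split => //.
    move=> W WE; have := WE _ El; rewrite col_depthE // => /(memvZ (s l)^-1).
    by rewrite scalerA mulVf ?scale1r ?gt_eqF ?s0.
  rewrite dim_vline; case: eqP => // d0; move: (ud l lv).
  by rewrite d0 /dot big1 => [/esym/eqP|? _];
    rewrite ?oppr_eq0 ?oner_eq0 // mxE mulr0.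
have [z [t [zdir t0 lz]]] := edge_primitive_direction ratP eE Ev El lv.
have : 0 < dot a (col l V - v) by rewrite col_depthE // dotZr mulr_gt0 ?s0.
by rewrite lz dotZr pmulr_rgt0 // ltNge az.
Qed.

End Cone.

(** * Unimodular charts at the vertices of a monotone polytope *)

Section Chart.
Local Open Scope classical_set_scope.
Local Open Scope ring_scope.

Lemma columns_basis_unitmx n (B : 'M[int]_n) : columns_basis B -> B \in unitmx.
Proof.
move=> basB.
have solve (k : 'I_n) : exists c : 'cV[int]_n, delta_mx k 0 = B *m c.
  by have [c [cE _]] := basB (delta_mx k 0); exists c.
have [c cE] := choice solve.
suff /mulmx1_unit[] : B *m \matrix_(i, k) c k i 0 = 1%:M by [].
apply/matrixP => i k; rewrite [RHS]mxE.
have := congr1 (fun z : 'cV[int]_n => z i 0) (cE k).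
rewrite !mxE eqxx andbT => ->; apply: eq_bigr => j _.
by rewrite !mxE.
Qed.

(** In the coordinates given by the basis [B], the set [F] lies in the hyperplane
where the coordinate [j] is that of [v], and it contains [v] and one more point
on each of the other axes through [v]; these span the hyperplane. *)
Lemma has_dim_coordinate_hyperplane (R : realType) n (F : set 'cV[R]_n) v
    (j : 'I_n) (B C : 'M[R]_n) : C *m B = 1%:M -> F v ->
  (forall x, F x -> (C *m x) j 0 = (C *m v) j 0) ->
  (forall k, k != j -> exists2 t, t != 0 & F (v + t *: col k B)) ->
  has_dim F n.-1.
Proof.
case: n => [|d] in F v j B C *; first by case: j.
move=> CB Fv Fj Fk; pose X := [tuple col (lift j i) B | i < d].
have CBe k : C *m col k B = delta_mx k 0 by rewrite colE mulmxA CB mul1mx.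
have BC : B *m C = 1%:M by exact: mulmx1C.
have Xi (i : 'I_d) : X`_i = col (lift j i) B.
  by rewrite -tnth_nth tnth_mktuple.
exists v, <<X>>%VS; split => //.
- move=> x Fx.
  have -> : x - v = B *m (C *m (x - v)) by rewrite mulmxA BC mul1mx.
  rewrite mulmx_col_sum; apply: memv_suml => k _.
  have [->|[i ->]] : k = j \/ exists i, k = lift j i.
    by case: (unliftP j k) => [i ->|->]; [right; exists i|left].
    have -> : (C *m (x - v)) j 0 = 0.
      by rewrite mulmxBr [LHS]mxE [X in _ + X]mxE Fj // subrr.
    by rewrite scale0r mem0v.
  apply/memvZ/memv_span/tnthP; exists i; by rewrite tnth_mktuple.
- move=> W WF; apply/span_subvP => _ /tnthP[i ->]; rewrite tnth_mktuple.
  have [|t t0 Ft] := Fk (lift j i); first by rewrite eq_sym neq_lift.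
  have := WF _ Ft; rewrite addrC addKr => /(memvZ t^-1).
  by rewrite scalerA mulVf // scale1r.
- suff /eqP -> : free X by rewrite size_tuple.
  apply/freeP => c c0 i.
  have := congr1 (fun z => (C *m z) (lift j i) 0) c0.
  rewrite mulmx0 mulmx_sumr summxE [RHS]mxE (bigD1 i) // big1 => [|k ki].
    by rewrite Xi /= addr0 -scalemxAr CBe !mxE !eqxx mulr1.
  rewrite Xi -scalemxAr CBe !mxE.
  by rewrite (inj_eq lift_inj) eq_sym (negPf ki) mulr0.
Qed.

(** The rows of [U] are the normals of the facets through [v].  With [B] the
matrix of the primitive edge directions and [C] its inverse, the opposite of a
row of [C] is nonpositive on every edge direction, so it is maximal at [v] and
defines a face, which is a facet since it contains all the edges but one.  The
integer normal [u] given by reflexivity is orthogonal to the same edges, hence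
is an integer multiple of that row; [u] being primitive, the factor is a unit,
and its sign is that of [u] on the remaining edge. *)
Lemma monotone_vertex_chart (R : realType) n (P : set 'cV[R]_n) v :
  monotone_polytope P -> vertex P v ->
  exists2 U : 'M[int]_n, U \in unitmx &
    (forall x, P x -> forall i, (map_mx intr U *m x) i 0 <= 1) /\
    forall i, (map_mx intr U *m v) i 0 = 1.
Proof.
move=> [[polP _ _ ratP smoothP] [_ _ reflP]] vv.
have [B /columns_basis_unitmx uB Bdir] := smoothP v vv.
have Pv := vertex_in vv.
pose C := invmx B.
pose rB : 'M[R]_n := map_mx intr B; pose rC : 'M[R]_n := map_mx intr C.
have CB : rC *m rB = 1%:M by rewrite -map_mxM mulVmx // map_mx1.
have edgeB k : exists E t, [/\ face P E, E v, 0 < t & E (v + t *: col k rB)].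
  have : primitive_edge_directions P v (col k B) by rewrite Bdir; exists k.
  by case=> _ [E [t [[fE _] Ev t0 Et]]]; exists E, t; rewrite -map_col.
have PB k : exists2 t, 0 < t & P (v + t *: col k rB).
  have [E [t [[u [c [_ ->]]] _ t0 [Pt _]]]] := edgeB k.
  by exists t.
pose a j : 'cV[R]_n := - (row j rC)^T.
have aE j x : dot (a j) x = - (rC *m x) j 0.
  by rewrite dotE linearN /= trmxK mulNmx mxE -row_mul mxE.
have amax j x : P x -> dot (a j) x <= dot (a j) v.
  apply: (vertex_max_of_edges polP ratP vv) => z; rewrite Bdir => -[k _ <-].
  rewrite aE map_col -/rB colE mulmxA CB mul1mx mxE eqxx andbT oppr_le0.
  exact: ler0n.
have facetP j : exists2 u : 'cV[int]_n, primitive u &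
    face_by P (P `&` [set x | dot (a j) x = dot (a j) v]) (map_mx intr u) 1.
  apply: reflP; split.
    by exists (a j), (dot (a j) v); split => //; exact: amax.
  exists n.-1; first by rewrite prednK // (leq_ltn_trans _ (ltn_ord j)).
  apply: (has_dim_coordinate_hyperplane (v := v) (j := j) CB) => //.
    by move=> x [_ /= /eqP]; rewrite !aE eqr_opp => /eqP ->.
  move=> k kj; have [t t0 Pt] := PB k; exists t; first by rewrite gt_eqF.
  split => //=; rewrite dotDr dotZr [dot _ (col _ _)]aE colE mulmxA CB mul1mx.
  by rewrite mxE eq_sym (negPf kj) oppr0 mulr0 addr0.
have normalE j x : P x -> dot (a j) x <= 1 /\ dot (a j) v = 1.
  move=> Px; have [u u1 [ule uF]] := facetP j.
  have uv : dot (map_mx intr u) v = 1.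
    have : (P `&` [set x | dot (map_mx intr u) x = 1]) v by rewrite -uF.
    by case.
  (* The entries of [m] are the values of [u] on the edge directions. *)
  pose m := u^T *m B.
  have mE k : (m 0 k)%:~R = dot (map_mx intr u) (col k rB).
    have -> : m 0 k = (u^T *m col k B) 0 0 by rewrite colE mulmxA -colE [RHS]mxE.
    by rewrite dotE map_trmx -map_col -map_mxM [RHS]mxE.
  have m0 k : k != j -> m 0 k = 0.
    move=> kj; apply/eqP; rewrite -(intr_eq0 R) mE.
    have [t t0 Pt] := PB k.
    have : (P `&` [set x | dot (map_mx intr u) x = 1]) (v + t *: col k rB).
      rewrite -uF; split => //=.
      rewrite dotDr dotZr [dot _ (col _ _)]aE colE mulmxA CB mul1mx.
      by rewrite mxE eq_sym (negPf kj) oppr0 mulr0 addr0.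
    case=> _ /= /eqP; rewrite dotDr dotZr uv -subr_eq0 addrAC subrr add0r.
    by rewrite mulf_eq0 gt_eqF.
  have uC : u^T = m *m C by rewrite -mulmxA mulmxV ?mulmx1.
  (* The body of [m] is hidden so that [mxE] does not expand its entries. *)
  clearbody m; have mj : m 0 j <= 0.
    rewrite -(lerz0 R) mE; have [t t0 /ule] := PB j.
    by rewrite dotDr dotZr uv gerDl pmulr_rle0.
  have uE : u^T = m 0 j *: row j C.
    rewrite uC mulmx_sum_row (bigD1 j) //= big1 ?addr0 // => k kj.
    by rewrite m0 // scale0r.
  have mj1 : m 0 j = -1.
    have mj1 : absz (m 0 j) = 1%N.
      move/primitiveP: u1; apply=> i.
      have -> : u i ord0 = u^T 0 i by rewrite mxE.
      by rewrite uE mxE abszM dvdn_mulr.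
    by rewrite -[m 0 j]opprK -(ler0_norm mj) -abszE mj1.
  have -> : a j = map_mx intr u.
    by rewrite -[u]trmxK uE mj1 scaleN1r; apply/matrixP => i k; rewrite !mxE rmorphN.
  by split; [exact: ule|].
exists (- C); first by rewrite -scaleN1r unitmxZ ?unitrN1 ?unitmx_inv.
rewrite map_mxN; split=> [x Px i|i]; rewrite mulNmx mxE -aE.
  by have [] := normalE i x Px.
by have [] := normalE i v Pv.
Qed.

End Chart.

(** * Invariance under linear maps *)

Section LinearImage.
Local Open Scope classical_set_scope.
Local Open Scope ring_scope.
Variables (R : realType) (n : nat).
Implicit Types (P F : set 'cV[R]_n) (A : 'M[R]_n).

Definition img A P := [set A *m x | x in P].

Lemma imgK A A' : A' *m A = 1%:M -> cancel (img A) (img A').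
Proof.
move=> AA' P; rewrite /img image_comp; apply/seteqP; split=> [_ [x Px <-]|x Px].
  by rewrite /= mulmxA AA' mul1mx.
by exists x; rewrite //= mulmxA AA' mul1mx.
Qed.

Lemma img_set1 A v : img A [set v] = [set A *m v].
Proof. exact: image_set1. Qed.

Lemma dot_img A A' u x : A' *m A = 1%:M -> dot (A'^T *m u) (A *m x) = dot u x.
Proof. by move=> AA'; rewrite -dot_mulmx mulmxA AA' mul1mx. Qed.

(** A linear form that exposes the face is replaced by its transport under the
inverse transpose. *)
Lemma face_img A A' P F : A' *m A = 1%:M -> face P F -> face (img A P) (img A F).
Proof.
move=> AA' [u [c [uc ->]]]; exists (A'^T *m u), c; split.
  by move=> _ [x Px <-]; rewrite dot_img //; exact: uc.
apply/seteqP; split=> [_ [x [Px /= ux] <-]|_ [[x Px <-]]] /=.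
  by split; [exists x|rewrite /= dot_img].
by rewrite dot_img // => ux; exists x.
Qed.

Lemma has_dim_img A A' P d : A' *m A = 1%:M -> has_dim P d -> has_dim (img A P) d.
Proof.
move=> AA' [x0 [U [Px0 PU minU dimU]]].
pose f : 'Hom('cV[R]_n, 'cV[R]_n) := linfun (mulmx A).
have fE x : f x = A *m x by rewrite lfunE.
exists (A *m x0), (f @: U)%VS; split.
- by exists x0.
- by move=> _ [x Px <-]; rewrite -mulmxBr -fE memv_img // PU.
- move=> W WP; have /(limgS f) : (U <= f @^-1: W)%VS.
    apply: minU => x Px; rewrite -memv_preim fE mulmxBr.
    by apply: WP; exists x.
  move=> /subv_trans; apply; apply/subvP => _ /memv_imgP[x xW ->].
  by rewrite memv_preim.
- rewrite limg_dim_eq //; apply/eqP; rewrite -subv0.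
  have /eqP -> : lker f == 0%VS.
    apply/lker0P => x y; rewrite !fE => /(congr1 (mulmx A')).
    by rewrite !mulmxA AA' !mul1mx.
  exact: capvSr.
Qed.

Lemma edge_img A A' P E : A' *m A = 1%:M -> edge P E -> edge (img A P) (img A E).
Proof.
by move=> AA' [? ?]; split; [exact: face_img AA' _|exact: has_dim_img AA' _].
Qed.

Lemma facet_img A A' P E : A' *m A = 1%:M -> facet P E -> facet (img A P) (img A E).
Proof.
move=> AA' [? [d nd ?]]; split; first exact: face_img AA' _.
by exists d => //; exact: has_dim_img AA' _.
Qed.

Lemma vertex_img A A' P v : A' *m A = 1%:M -> vertex P v ->
  vertex (img A P) (A *m v).
Proof.
by move=> AA' vv; rewrite /vertex -img_set1; exact: face_img AA' vv.
Qed.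

Lemma polytope_img A P : polytope P -> polytope (img A P).
Proof.
move=> [k [V ->]]; exists k, (A *m V); rewrite /img image_comp.
by apply: eq_imagel => c _ /=; rewrite mulmxA.
Qed.

(** The image is the preimage under the inverse map, whose coordinates are
continuous at 0. *)
Lemma interior_img A A' P : A' *m A = 1%:M -> interior P 0 -> interior (img A P) 0.
Proof.
move=> AA' [Q Q0 QP].
have AA : A *m A' = 1%:M by exact: mulmx1C.
suff : \forall y \near (0 : 'cV[R]_n), forall i j, Q i j ((A' *m y) i j).
  apply: filterS => y Qy; exists (A' *m y); last by rewrite mulmxA AA mul1mx.
  exact: QP.
apply: (filter_forall (f := fun i y => forall j, Q i j ((A' *m y) i j))
  (nbhs_filter _)) => i.
apply: (filter_forall (f := fun j y => Q i j ((A' *m y) i j))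
  (nbhs_filter _)) => j.
suff cv : (fun y : 'cV[R]_n => (A' *m y) i j) @ (0 : 'cV[R]_n)
    --> (0 : 'cV[R]_n) i j by exact: (cv _ (Q0 i j)).
rewrite [X in X @ _](_ : _ = fun y : 'cV[R]_n => \sum_k A' i k * y k j); last first.
  by apply/funext => y; rewrite mxE.
rewrite [X in _ --> X](_ : _ = \sum_k A' i k * (0 : 'cV[R]_n) k j); last first.
  by rewrite mxE big1 // => k _; rewrite mxE mulr0.
apply: (cvg_big add_continuous (F := nbhs (0 : 'cV[R]_n))) => k _.
by apply: cvgM; [exact: cvg_cst|exact: coord_continuous].
Qed.

End LinearImage.

Section UnimodularImage.
Local Open Scope classical_set_scope.
Local Open Scope card_scope.
Local Open Scope ring_scope.

(** A common divisor of the coordinates of [Z *m u] divides those of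
[u = Z^-1 *m (Z *m u)]. *)
Lemma primitive_mulmx n (Z : 'M[int]_n) u : Z \in unitmx ->
  primitive u -> primitive (Z *m u).
Proof.
move=> uZ /primitiveP u1; apply/primitiveP => d dZu; apply: u1 => i.
rewrite -[u]mul1mx -(mulVmx uZ) -mulmxA mxE.
suff : (d%:Z %| \sum_j invmx Z i j * (Z *m u) j ord0)%Z by [].
by apply: rpred_sum => j _; apply: dvdz_mull; exact: dZu.
Qed.

Variables (R : realType) (n : nat) (Z : 'M[int]_n).
Hypothesis uZ : Z \in unitmx.
Implicit Types (P F : set 'cV[R]_n).

Let A : 'M[R]_n := map_mx intr Z.
Let A' : 'M[R]_n := map_mx intr (invmx Z).

Let AA' : A' *m A = 1%:M.
Proof. by rewrite -map_mxM mulVmx // map_mx1. Qed.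

Let A'A : A *m A' = 1%:M.
Proof. exact: mulmx1C AA'. Qed.

Let mulAK w : w = A *m (A' *m w) :> 'cV[R]_n.
Proof. by rewrite mulmxA A'A mul1mx. Qed.

Let imgAK F : F = img A (img A' F).
Proof. by rewrite (imgK A'A). Qed.

Lemma vertex_img_inv P w : vertex (img A P) w ->
  exists2 v, vertex P v & w = A *m v.
Proof.
move=> /(vertex_img A'A); rewrite (imgK AA') => ?.
by exists (A' *m w); last exact: mulAK.
Qed.

Lemma edge_img_inv P E : edge (img A P) E -> exists2 G, edge P G & E = img A G.
Proof.
move=> /(edge_img A'A); rewrite (imgK AA') => ?.
by exists (img A' E); last exact: imgAK.
Qed.

Lemma facet_img_inv P E : facet (img A P) E -> exists2 G, facet P G & E = img A G.
Proof.
move=> /(facet_img A'A); rewrite (imgK AA') => ?.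
by exists (img A' E); last exact: imgAK.
Qed.

Lemma img_mem P x : img A P (A *m x) <-> P x.
Proof.
split=> [[y Py yx]|Px]; last by exists x.
by rewrite -[x]mul1mx -AA' -mulmxA -yx mulmxA AA' mul1mx.
Qed.

Lemma primitive_edge_directions_img P v u :
  primitive_edge_directions P v u <->
  primitive_edge_directions (img A P) (A *m v) (Z *m u).
Proof.
split=> -[u1 [E [t [eE Ev t0 Et]]]].
  split; first exact: primitive_mulmx.
  exists (img A E), t; split=> //; first exact: edge_img AA' eE.
    exact/img_mem.
  by rewrite map_mxM scalemxAr -mulmxDr; exact/img_mem.
have [G eG EG] := edge_img_inv eE; split.
  rewrite -[u]mul1mx -(mulVmx uZ) -mulmxA.
  by apply: primitive_mulmx; rewrite ?unitmx_inv.
exists G, t; split=> //; first by apply/img_mem; rewrite -EG.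
by apply/img_mem; rewrite -EG mulmxDr -scalemxAr -map_mxM.
Qed.

(** Faces of every dimension, lattice points and primitive vectors correspond to
each other under the unimodular map; facet normals are transported by the
inverse transpose, which is unimodular as well. *)
Lemma monotone_img P : monotone_polytope P -> monotone_polytope (img A P).
Proof.
move=> [[polP dimP simP ratP smoothP] [[_ latP] intP reflP]].
have ratQ : rational_polytope (img A P).
  move=> _ /edge_img_inv[E eE ->]; have [u u0 uE] := ratP E eE.
  exists (Z *m u).
    apply: contraNneq u0 => /(congr1 (mulmx (invmx Z))).
    by rewrite mulmxA mulVmx // mul1mx mulmx0 => ->.
  move=> _ _ [x Ex <-] [y Ey <-]; have [t xy] := uE x y Ex Ey.
  by exists t; rewrite -mulmxBr xy map_mxM scalemxAr.
split; split=> //; first exact: polytope_img.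
- exact: has_dim_img AA' dimP.
- move=> _ /vertex_img_inv[v vv ->].
  apply: card_eq_trans (simP v vv).
  rewrite (_ : [set E | _] = img A @` [set E | edge P E /\ E v]).
    by apply: inj_card_eq => ? ? _ _; apply: (can_inj (imgK AA')).
  apply/seteqP; split=> [E /= [/edge_img_inv[G eG ->] /img_mem Gv]|_ [E [eE Ev] <-]].
    by exists G.
  by split; [exact: edge_img AA' eE|exact/img_mem].
- move=> _ /vertex_img_inv[v vv ->]; have [B basB BP] := smoothP v vv.
  exists (Z *m B).
    move=> z; have [c [zc cu]] := basB (invmx Z *m z); exists c; split.
      by rewrite -mulmxA -zc mulmxA mulmxV // mul1mx.
    by move=> c' zc'; apply: cu; rewrite zc' !mulmxA mulVmx // mul1mx.
  apply/seteqP; split=> [u|_ [j _ <-]].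
    rewrite -[u]mul1mx -(mulmxV uZ) -mulmxA => /(primitive_edge_directions_img P v _).2.
    by rewrite BP => -[j _ <-]; exists j => //; rewrite !colE mulmxA.
  rewrite colE -mulmxA -colE; apply/(primitive_edge_directions_img P v).
  by rewrite BP; exists j.
- split; first exact: polytope_img.
  move=> _ /vertex_img_inv[v /latP[z _ <-] ->].
  by exists (Z *m z) => //; rewrite map_mxM.
- exact: interior_img AA' intP.
- move=> _ /facet_img_inv[F /reflP[u u1 [uP FE]] ->].
  have uZe x : dot (map_mx intr ((invmx Z)^T *m u)) (A *m x) = dot (map_mx intr u) x.
    by rewrite map_mxM -map_trmx (dot_img _ _ AA').
  exists ((invmx Z)^T *m u).
    by apply: primitive_mulmx; rewrite ?unitmx_tr ?unitmx_inv.
  split; first by move=> _ [x Px <-]; rewrite uZe; exact: uP.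
  rewrite FE; apply/seteqP; split=> [_ [x [Px /= ux] <-]|_ [[x Px <-]]] /=.
    by split; [exists x|rewrite /= uZe].
  by rewrite uZe => ux; exists x.
Qed.

End UnimodularImage.

(** * The cube and its Ewald set *)

Section Cube.
Local Open Scope classical_set_scope.
Local Open Scope card_scope.
Local Open Scope ring_scope.

Lemma card_setT_finType (T : finType) : [set: T] #= `I_#|T|.
Proof.
rewrite (_ : [set: T] = [set` [fset x in T]%fset]); last first.
  by apply/seteqP; split=> // x _; rewrite /= !inE.
by apply/card_eq_fsetP; rewrite card_finset.
Qed.

Lemma subset_card_eq (T : choiceType) (A B : set T) m :
  A `<=` B -> B #<= `I_m -> A #= `I_m -> A = B.
Proof.
move=> AB Bm Am.
have finB : finite_set B by apply: card_le_finite Bm _; exact: finite_II.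
have finA : finite_set A by exact: sub_finite_set finB.
apply: fset_set_inj => //; apply/eqP.
rewrite eqEfcard (card_fset_set Am) geq_card_fset_set // andbT.
by rewrite -fset_set_sub.
Qed.

Variables (R : realType) (n : nat).
Implicit Types (P Q : set 'cV[R]_n).

(** A lattice point of the cube is determined by its coordinates plus 1, which
are in {0, 1, 2}. *)
Lemma card_ewald_cube : ewald (cube R n) #<= `I_(3 ^ n).
Proof.
pose g (f : {ffun 'I_n -> 'I_3}) : 'cV[R]_n :=
  map_mx intr (\col_i ((f i : nat)%:Z - 1)).
have sub : ewald (cube R n) `<=` g @` setT.
  move=> _ [[[z _ <-] zC] _].
  have z1 i : (-1 <= z i ord0) && (z i ord0 <= 1).
    have /andP[] := zC i; rewrite mxE => lo hi.
    by apply/andP; split; rewrite -(ler_int R) ?rmorphN.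
  have z3 i : (absz (z i ord0 + 1)%R < 3)%N.
    by case/andP: (z1 i) => *; lia.
  exists [ffun i => Ordinal (z3 i)] => //.
  apply/matrixP => i j; rewrite (_ : j = ord0) ?[LHS]ord1 //.
  rewrite !mxE ffunE /=; congr (_ %:~R).
  by case/andP: (z1 i) => *; lia.
apply: card_le_trans (subset_card_le sub) _.
apply: card_le_trans (card_image_le _ _) _.
have := card_setT_finType {ffun 'I_n -> 'I_3}.
by rewrite card_ffun !card_ord => /card_eqPle[].
Qed.

Lemma ewald_sub_cube Q : (forall x, Q x -> forall i, x i 0 <= 1) ->
  ewald Q `<=` ewald (cube R n).
Proof.
move=> Q1 x [[Lx Qx] [y Qy yx]]; move: Lx Qx; rewrite -yx => Lx Qx.
have C : cube R n (- y).
  by move=> i; rewrite Q1 // andbT mxE lerN2 Q1.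
split=> //; exists y => // i; rewrite -[y]opprK mxE lerN2 lerNl.
by have /andP[-> ->] := C i.
Qed.

Lemma polytope_convex P x y (t : R) : polytope P -> P x -> P y -> 0 <= t <= 1 ->
  P (t *: x + (1 - t) *: y).
Proof.
move=> [k [V ->]] [c [c0 c1] <-] [d [d0 d1] <-] /andP[t0 t1].
exists (t *: c + (1 - t) *: d); last by rewrite mulmxDr -!scalemxAr.
split=> [i|]; first by rewrite !mxE addr_ge0 // mulr_ge0 // subr_ge0.
under eq_bigr do rewrite !mxE.
by rewrite big_split -!mulr_sumr c1 d1 !mulr1 /= addrC subrK.
Qed.

(** By induction on [k], a point of the cube whose coordinates from index [k] on
are signs is in P: it lies on the segment between the two points obtained by
moving its coordinate [k - 1] to 1 and to -1. *)
Lemma cube_sub_convex P : polytope P ->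
  (forall x : 'cV[R]_n, (forall i, x i 0 = 1 \/ x i 0 = -1) -> P x) ->
  cube R n `<=` P.
Proof.
move=> polP signP.
suff H k : forall x, cube R n x ->
    (forall i : 'I_n, (k <= i)%N -> x i 0 = 1 \/ x i 0 = -1) -> P x.
  by move=> x Cx; apply: (H n x Cx) => i; rewrite leqNgt ltn_ord.
elim: k => [|k IH] x Cx xk; first by apply: signP => i; exact: xk.
have [kn|nk] := ltnP k n; last first.
  by apply: IH => // i ki; have := leq_trans nk ki; rewrite leqNgt ltn_ord.
pose i := Ordinal kn.
pose y (s : R) : 'cV[R]_n := \col_j (if j == i then s else x j 0).
have Py s : s = 1 \/ s = -1 -> P (y s).
  move=> s1; apply: IH => j; rewrite mxE; case: ifPn => // ji.
    by case: s1 => ->; lra.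
  move=> kj; apply: xk; rewrite ltn_neqAle kj andbT.
  by apply: contraNneq ji => kj'; apply/eqP/val_inj.
rewrite (_ : x = ((1 + x i 0) / 2) *: y 1 + (1 - (1 + x i 0) / 2) *: y (-1)).
  apply: polytope_convex; [exact: polP|apply: Py; by left|apply: Py; by right|].
  by have /andP[] := Cx i; lra.
apply/matrixP => j l; rewrite !mxE ord1; case: eqVneq => [->|_]; lra.
Qed.

End Cube.

(** * Ewald sets of monotone polytopes *)

Section EwaldMonotone.
Local Open Scope classical_set_scope.
Local Open Scope card_scope.
Local Open Scope ring_scope.
Variables (R : realType) (n : nat).
Implicit Types (P Q : set 'cV[R]_n).

(** Evaluating a row of [U] at the sign vector of its own entries shows that the
sum of their absolute values is at most 1, so the row has a single nonzero
entry, 1 or -1.  As [U] is invertible, each column [j] meets such a row, and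
this row computes [w j] up to sign. *)
Lemma sign_chart_vertex (U : 'M[int]_n) (w : 'cV[R]_n) : U \in unitmx ->
  (forall x : 'cV[R]_n, (forall i, x i 0 = 1 \/ x i 0 = -1) ->
     forall i, (map_mx intr U *m x) i 0 <= 1) ->
  (forall i, (map_mx intr U *m w) i 0 = 1) ->
  cube R n w.
Proof.
move=> uU Ule Uw j.
have [i Uij] : exists i, U i j != 0.
  apply: contrapT => /forallNP U0.
  have := congr1 (fun M : 'M[int]_n => M j j) (mulVmx uU).
  rewrite !mxE eqxx big1 => [|k _]; first by move=> /esym/eqP; rewrite oner_eq0.
  by have /negP/negPn/eqP-> := U0 k; rewrite mulr0.
have norm1 : \sum_k `|U i k| <= 1.
  rewrite -(ler_int R) rmorph_sum /=.
  pose s : 'cV[R]_n := \col_k (if 0 <= U i k then 1 else -1).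
  have s1 k : s k 0 = 1 \/ s k 0 = -1.
    by rewrite mxE; case: ifP; [left|right].
  apply: le_trans (Ule s s1 i); rewrite mxE le_eqVlt; apply/orP; left.
  apply/eqP/eq_bigr => k _; rewrite !mxE.
  case: ifPn => Uk; first by rewrite mulr1 ger0_norm.
  by rewrite mulrN1 ltr0_norm ?rmorphN // ltNge.
have Uij1 : 1 <= `|U i j| by rewrite -gtz0_ge1 normr_gt0.
have rest k : k != j -> U i k = 0.
  move=> kj; apply/eqP; rewrite -normr_eq0 eq_le normr_ge0 andbT.
  move: norm1; rewrite (bigD1 j) //= (bigD1 k) //= => norm1.
  have : 0 <= \sum_(l | (l != j) && (l != k)) `|U i l| by exact: sumr_ge0.
  by move: Uij1 norm1; clear; lra.
have := Uw i; rewrite mxE (bigD1 j) //= big1 => [|k kj]; last first.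
  by rewrite mxE rest // mul0r.
have : `|U i j| = 1.
  move: norm1; rewrite (bigD1 j) //= big1 ?addr0 => [norm1|k kj].
    by apply/le_anti; rewrite norm1.
  by rewrite rest // normr0.
rewrite addr0 mxE => Un.
have [->|->] : U i j = 1 \/ U i j = -1 by lia.
  by rewrite mul1r => ->; lra.
by rewrite rmorphN mulN1r => wj; lra.
Qed.

Lemma monotone_nonempty P : monotone_polytope P -> P !=set0.
Proof. by move=> [[_ [x [_ [Px _ _ _]]] _ _ _] _]; exists x. Qed.

Lemma monotone_polytope_polytope P : monotone_polytope P -> polytope P.
Proof. by move=> [[]]. Qed.

(** The sign vectors are points of the Ewald set of the cube, so Q contains the
cube; and they bound the facet normals of Q so much that all the vertices of Q
are sign vectors themselves. *)
Lemma monotone_eq_cube Q : monotone_polytope Q -> ewald (cube R n) `<=` Q ->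
  Q = cube R n.
Proof.
move=> monQ CQ; have polQ := monotone_polytope_polytope monQ.
have Q0 := monotone_nonempty monQ.
have signQ (x : 'cV[R]_n) : (forall i, x i 0 = 1 \/ x i 0 = -1) -> Q x.
  move=> x1; apply: CQ.
  have Cx : cube R n x by move=> i; case: (x1 i) => ->; lra.
  split; last first.
    exists (- x); last exact: opprK.
    by move=> i; rewrite mxE; case: (x1 i) => ->; lra.
  split=> //; exists (\col_i (if x i 0 == 1 then 1 else -1)) => //.
  apply/matrixP => i j; rewrite !mxE ord1.
  by case: eqP => [-> //|xi]; case: (x1 i) => // ->; rewrite rmorphN.
have vertexC w : vertex Q w -> cube R n w.
  move=> vw; have [U uU [Ule Uw]] := monotone_vertex_chart monQ vw.
  by apply: (sign_chart_vertex uU) => // x /signQ; exact: Ule.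
apply/seteqP; split; last exact: cube_sub_convex.
move=> x Qx i.
have dotd (y : 'cV[R]_n) : dot (delta_mx i 0) y = y i 0.
  rewrite dotC /dot (bigD1 i) //= mxE !eqxx mulr1 big1 ?addr0 // => k ki.
  by rewrite mxE (negPf ki) mulr0.
(* The coordinate [i] and its opposite are maximal on Q at vertices, where they
   are at most 1. *)
have [w [/vertexC/(_ i)/andP[_ w1] /(_ _ Qx)]] :=
  polytope_vertex_max (delta_mx i 0) polQ Q0.
have [w' [/vertexC/(_ i)/andP[w'1 _] /(_ _ Qx)]] :=
  polytope_vertex_max (- delta_mx i 0) polQ Q0.
rewrite ![dot (- _) _]dotC !dotNr ![dot _ (delta_mx _ _)]dotC !dotd.
by lra.
Qed.

Lemma ewald_img (U : 'M[int]_n) P : U \in unitmx ->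
  ewald (img (map_mx intr U) P) = img (map_mx intr U) (ewald P).
Proof.
move=> uU.
have VU : map_mx intr (invmx U) *m map_mx intr U = 1%:M :> 'M[R]_n.
  by rewrite -map_mxM mulVmx // map_mx1.
apply/seteqP; split=> [_ [[[z _ <-] [x Px xz]] [_ [y Py <-] yz]]|].
  rewrite -xz; exists x => //.
  have xE : x = map_mx intr (invmx U *m z) by rewrite map_mxM -xz mulmxA VU mul1mx.
  split; first by split=> //; exists (invmx U *m z).
  exists y => //; rewrite xE map_mxM -yz mulmxN mulmxA VU mul1mx //.
move=> _ [_ [[[z _ <-] Pz] [y Py yz]] <-]; split.
  by split; [exists (U *m z); rewrite // map_mxM|exists (map_mx intr z)].
by exists (map_mx intr U *m y); [exists y|rewrite -yz mulmxN].
Qed.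

End EwaldMonotone.

Local Open Scope classical_set_scope.
Local Open Scope card_scope.

Theorem proposition6p1 (R : realType) (n : nat) (P : set 'cV[R]_n)
    (monoP : monotone_polytope P) :
  (exists Q : set 'cV[R]_n,
     [/\ monotone_polytope Q, unimodularly_equivalent P Q & ewald Q `<=` ewald (cube R n)])
  /\ ewald P #<= `I_(3 ^ n)
  /\ (ewald P #= `I_(3 ^ n) -> unimodularly_equivalent P (cube R n)).
Proof.
have [v [vv _]] := polytope_vertex_max 0%R (monotone_polytope_polytope monoP)
  (monotone_nonempty monoP).
have [U uU [Ule _]] := monotone_vertex_chart monoP vv.
pose Q : set 'cV[R]_n := img (map_mx intr U) P.
have monQ : monotone_polytope Q by exact: monotone_img.
have PQ : unimodularly_equivalent P Q.
  exists U, 0%R; split => //.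
  by rewrite map_mx0; apply: eq_imagel => x _; rewrite addr0.
have QC : ewald Q `<=` ewald (cube R n).
  by apply: ewald_sub_cube => _ [x Px <-]; exact: Ule.
have cardPQ : ewald Q #= ewald P.
  rewrite ewald_img //; apply: inj_card_eq => x y _ _.
  move=> /(congr1 (mulmx (map_mx intr (invmx U)))).
  by rewrite !mulmxA -map_mxM mulVmx // map_mx1 !mul1mx.
split; first by exists Q.
split.
  rewrite -(card_le_eql cardPQ).
  exact: card_le_trans (subset_card_le QC) (card_ewald_cube _ _).
move=> cardP.
have QE := subset_card_eq QC (card_ewald_cube _ _) (card_eq_trans cardPQ cardP).
rewrite -(monotone_eq_cube monQ) // -QE.
by move=> x [[]].
Qed.
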